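(* For every ordinal number $\beta<\omega_1$, the set of all functions $F:\mathbb{R}\to\mathbb{R}$ of Baire class $\beta$ such that for every nonempty open set $U\subseteq\mathbb{R}$ the restriction $F|_U\notin\bigcup_{\alpha<\beta}\mathcal{B}_\alpha$ (that is, $F|_U:U\to\mathbb{R}$ is not of Baire class $\alpha$ on $U$ for any $\alpha<\beta$) is strongly $\mathfrak{c}$-algebrable (as a subset of the algebra $\mathbb{R}^{\mathbb{R}}$).
   Context: For $X=\mathbb{R}$ or $X$ a nonempty open subset of $\mathbb{R}$, Baire classes of functions $X\to\mathbb{R}$ are defined as follows: $\mathcal{B}_0$ is the set of continuous functions; $\mathcal{B}_1$ is the set of pointwise limits of sequences of continuous functions; for $1<\beta<\omega_1$, $\mathcal{B}_\beta$ (Baire class $\beta$) is the set of pointwise limits of sequences of functions from $\bigcup_{\alpha<\beta}\mathcal{B}_\alpha$. $\mathfrak{c}=2^{\omega}$ is the cardinality of the continuum. $\mathbb{R}^{\mathbb{R}}$ is the real commutative algebra of all functions $\mathbb{R}\to\mathbb{R}$ with pointwise operations. A subset $S$ of a commutative real algebra $\mathcal{L}$ is strongly $\kappa$-algebrable if $S\cup\{0\}$ contains a $\kappa$-generated algebra isomorphic to a free (commutative, non-unital) algebra; equivalently, there is a set $X\subseteq\mathcal{L}$ of cardinality $\kappa$ such that for every $k\ge 1$, every nonzero real polynomial $P$ in $k$ variables without constant term and all distinct $y_1,\dots,y_k\in X$, we have $P(y_1,\dots,y_k)\neq 0$ and $P(y_1,\dots,y_k)\in S$. *)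

(* Defs.v *)
From HB Require Import structures.
From mathcomp Require Import all_boot all_order all_algebra.
From mathcomp Require mpoly.

Set Implicit Arguments.
Unset Strict Implicit.
Unset Printing Implicit Defensive.

Import Order.TTheory GRing.Theory Num.Theory.
Local Open Scope ring_scope.

(* [mpoly] is imported only inside this module, before mathcomp-analysis is
   loaded, because the notations of the two libraries are incompatible. *)
Module RealPoly.
Import mpoly.

Definition nonzero_without_constant_term (K : comNzRingType) (k : nat)
  (P : {mpoly K[k]}) : Prop := P != 0 /\ P@_(0%MM) = 0.

(* The element P(y_1, ..., y_k) of the algebra of all functions T -> K, whose
   operations are pointwise. *)
Definition eval_fct (T : Type) (K : comNzRingType) (k : nat)
  (P : {mpoly K[k]}) (y : 'I_k -> T -> K) : T -> K :=
  fun x => P.@[fun i => y i x].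

End RealPoly.

From mathcomp Require Import all_classical all_reals all_analysis.
Import numFieldNormedType.Exports.
Local Open Scope classical_set_scope.

(* The cardinal kappa is given by a set [A] having that cardinality. *)
Definition strongly_algebrable (R : realType) (T U : Type) (A : set U)
    (S : set (T -> R)) : Prop :=
  exists2 X : set (T -> R), (X #= A)%card &
    forall (k : nat) (P : mpoly.mpoly k R) (y : 'I_k -> T -> R),
      (0 < k)%N ->
      RealPoly.nonzero_without_constant_term P ->
      injective y -> (forall i, X (y i)) ->
      RealPoly.eval_fct P y <> cst 0 /\ S (RealPoly.eval_fct P y).

(* [omega1_segment W] means that W is a well-order all of whose proper initial
   segments are countable, that is, whose order type is at most omega_1. The
   elements of such a W stand for the countable ordinals below its order type:
   b : W represents the order type of {a | a < b}. Every ordinal beta < omega_1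
   is represented in this way, e.g. in W = omega_1 or in W = beta + 1. *)
Definition omega1_segment (d : Order.disp_t) (W : orderType d) : Prop :=
  well_founded (fun a b : W => (a < b)%O) /\
  forall b : W, countable [set a : W | (a < b)%O].

(* [baire_class X b f] means that the restriction of f to X is of Baire class b
   on X; the values of f and of the u n outside X are irrelevant. Taking b
   minimal is the case of the ordinal 0. For b = 1, [baire_lim] yields the
   limits of sequences of continuous functions; there is no instance of
   [baire_lim] for b = 0, as it requires a n < b. *)
Inductive baire_class (R : realType) (d : Order.disp_t) (W : orderType d)
    (X : set R) : W -> (R -> R) -> Prop :=
| baire_continuous (b : W) (f : R -> R) :
    (forall a : W, (b <= a)%O) -> {within X, continuous f} ->
    baire_class X b f
| baire_lim (b : W) (a : nat -> W) (u : nat -> R -> R) (f : R -> R) :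
    (forall n, (a n < b)%O) -> (forall n, baire_class X (a n) (u n)) ->
    (forall x, X x -> u n x @[n --> \oo] --> f x) ->
    baire_class X b f.

Definition nowhere_lower_baire_class (R : realType) (d : Order.disp_t)
    (W : orderType d) (b : W) : set (R -> R) :=
  [set F | baire_class setT b F /\
    forall U : set R, open U -> U !=set0 ->
      ~ exists2 a : W, (a < b)%O & baire_class U a F].

(* Main.v *)
Require Import Defs.
From mathcomp Require Import all_boot all_order all_algebra.
From mathcomp Require mpoly.

Set Implicit Arguments.
Unset Strict Implicit.
Unset Printing Implicit Defensive.

Import Order.TTheory GRing.Theory Num.Theory.
Local Open Scope ring_scope.

(** The theorem rests on a function of class b that fails to be of any lower
class for reasons spread over countably many pairwise disjoint closed sets, so
that its values on these sets can be chosen independently of each other.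

Layers.  Let C_p be the set of reals x such that 10^p x is within 1/10 of an
integer (a tag), whereas 10^(p+m+1) x is at distance at least 2/10 from the
integers for every m; comparing the latter distances with 4/10 reads off the
bits of a subset of nat, the code of x. C_p is closed, and because a position
holding a tag cannot hold a bit, the C_p
are pairwise disjoint. Every open set contains, for all large p, a decimal
interval of length 10^-p in which every subset of nat occurs as a code. By
[exists_universal], for each a < b the sets {f > 0} with f of class a are the
sections U s of one relation U, whose pullback along any continuous coding
x -> code x is again {f > 0} for some f of class a. The set D_p of the x in C_p
with U (code x) x therefore has an indicator of class b; but by Cantor's
diagonal argument ([diagonal_set_neq]) no nonzero multiple of this indicator
agrees on C_p, within such a decimal interval, with a function of class a.

Generators.  For a set s of naturals put y_s = sum_p g_s(p) 1_(D_p), with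
0 <= g_s(p) <= 2^-p. The series converges uniformly, so y_s is of class b
([baire_class_dyadic_series]). As the D_p are disjoint and P has no constant
term, P(y_s1, ..., y_sk) equals P(g_s1(p), ..., g_sk(p)) 1_(D_p) on C_p. It
remains to make these coefficients nonzero for suitable p. Let g_s(p) be a power
of T = 2^-p whose exponent depends on s through finitely many bits, in a way
encoded in p, every finite pattern being met by infinitely many p. Kronecker's
substitution of powers of T turns P into a nonzero polynomial in T alone, which
has finitely many roots. The level a that D_p is meant to defeat is encoded in
p too, so each open set and each a < b meet a suitable p.

If b is least, class b is continuity and only the independence of the y_s is
needed; tent functions at the integers replace the indicators of the D_p. *)

(** * Kronecker's substitution *)

Module Kronecker.
Import mpoly.

Lemma base_expansion_inj (N k : nat) (m m' : 'I_k -> nat) :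
  (forall i, m i < N)%N -> (forall i, m' i < N)%N ->
  (\sum_i m i * N ^ i = \sum_i m' i * N ^ i)%N -> m =1 m'.
Proof.
elim: k m m' => [|k IHk] m m' ltm ltm' + i; first by case: i.
have N0 : (0 < N)%N by rewrite (leq_ltn_trans _ (ltm i)).
have split (n : 'I_k.+1 -> nat) :
    (\sum_j n j * N ^ j = (\sum_j n (lift ord0 j) * N ^ j) * N + n ord0)%N.
  rewrite big_ord_recl expn0 muln1 big_distrl addnC /=; congr addn.
  by apply: eq_bigr => j _; rewrite /bump add1n expnS mulnCA mulnC.
rewrite !split => eqmm'.
have eq0 : m ord0 = m' ord0.
  by have := congr1 (modn^~ N) eqmm'; rewrite !modnMDl !modn_small.
move: eqmm'; rewrite eq0 => /addIn/eqP; rewrite eqn_pmul2r // => /eqP eqmm'.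
case: (unliftP ord0 i) => [j|] -> //.
by apply: (IHk (fun j => m (lift ord0 j)) (fun j => m' (lift ord0 j))).
Qed.

(** With N above every exponent of P, replacing the i-th variable by T^(N^i)
sends distinct monomials to distinct powers of T, by uniqueness of base N
expansions, so that no cancellation can occur. *)
Lemma kronecker_substitution (K : idomainType) (k : nat) (P : {mpoly K[k]}) :
  P != 0 ->
  exists (e : 'I_k -> nat) (Q : {poly K}), [/\ forall i, (0 < e i)%N, Q != 0 &
    forall T : K, P.@[fun i => T ^+ e i] = Q.[T]].
Proof.
move=> P0; pose N := (msize P).+1.
pose w (m : 'X_{1..k}) := (\sum_i m i * N ^ i)%N.
exists (fun i => N ^ i)%N, (\sum_(m <- msupp P) P@_m *: 'X^(w m)); split.
- by move=> i; rewrite expn_gt0.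
- have [m mP] : exists m, m \in msupp P.
    by case: (msupp P) (msupp_eq0 P) P0 => [|m s]; [move=> <- | exists m; rewrite mem_head].
  apply: contraTneq mP => /(congr1 (fun q : {poly K} => q`_(w m))).
  rewrite coef0 coef_sum.
  apply: contra_eqN => mP.
  rewrite (bigD1_seq m) ?msupp_uniq //= coefZ coefXn eqxx mulr1 big1_seq ?addr0.
    by rewrite -mcoeff_msupp.
  move=> m' /andP[m'm m'P]; rewrite coefZ coefXn.
  case: eqP => [/esym wm|_]; last by rewrite mulr0.
  have ltN (n : 'X_{1..k}) : n \in msupp P -> forall i, (n i < N)%N.
    move=> /msize_mdeg_lt nP i; rewrite ltnS (leq_trans _ (ltnW nP)) // mdegE.
    by rewrite (bigD1 i) //= leq_addr.
  case/eqP: m'm; apply/mnmP.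
  exact: base_expansion_inj (ltN _ m'P) (ltN _ mP) wm.
- move=> T; rewrite mevalE horner_sum; apply: eq_bigr => m _.
  rewrite hornerZ hornerXn; congr (_ * _).
  by rewrite -prodrXr; apply: eq_bigr => i _; rewrite -exprM mulnC.
Qed.

Lemma meval_at0 (K : comNzRingType) (k : nat) (P : {mpoly K[k]}) :
  P.@[fun=> 0] = P@_0%MM.
Proof.
pose F (m : 'X_{1..k}) : K := \prod_i 0 ^+ m i.
have F0 m : F m = (m == 0%MM)%:R.
  have [->|m0] := eqVneq m 0%MM.
    by rewrite /F big1 // => i _; rewrite mnm0E expr0.
  have [i mi0] : exists i, m i != 0%N.
    apply/existsP; apply: contra_neqT m0; rewrite negb_exists => /forallP m0.
    by apply/mnmP => i; rewrite mnm0E; apply/eqP; rewrite -[_ == _]negbK m0.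
  by rewrite /F (bigD1 i) //= expr0n (negPf mi0) mul0r.
rewrite mevalE -/F; have [P0|P0] := boolP (0%MM \in msupp P).
  rewrite (bigD1_seq 0%MM) ?msupp_uniq //= -/(F _) F0 eqxx mulr1 big1 ?addr0 //.
  by move=> m /negPf m0; rewrite -/(F m) F0 m0 mulr0.
rewrite (memN_msupp_eq0 P0) big1_seq // => m /andP[_ mP].
rewrite -/(F m) F0; case: eqP => [m0|_]; last by rewrite mulr0.
by rewrite m0 (negPf P0) in mP.
Qed.

(** Applied to a relation between two generators, this polynomial shows that
they are distinct. *)
Lemma difference_of_variables (K : comNzRingType) (P := 'X_0 - 'X_1 : {mpoly K[2]}) :
  [/\ P != 0, P@_0%MM = 0 & forall v, P.@[v] = v 0 - v 1].
Proof.
have X0 (i : 'I_2) : ('X_i : {mpoly K[2]})@_0%MM = 0.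
  by rewrite mcoeffX mnm1_eq0.
split; last by move=> v; rewrite mevalB !mevalXU.
  apply/eqP => /(congr1 (mcoeff U_(ord0)%MM)).
  rewrite mcoeff0 mcoeffB !mcoeffXU eqxx subr0.
  by apply/eqP; rewrite oner_eq0.
by rewrite /P mcoeffB !X0 subr0.
Qed.
End Kronecker.

From mathcomp Require Import all_classical all_reals all_analysis.
From mathcomp Require Import ring lra.
Import numFieldNormedType.Exports.
Local Open Scope classical_set_scope.
Local Open Scope ring_scope.

(** * Series dominated by a geometric series *)

Section DyadicSeries.
Context {R : realType}.
Implicit Types v l : R^nat.

Lemma dyadic_tail v : (forall n, `|v n| <= 2^-1 ^+ n) ->
  forall N M, `|\sum_(N <= n < M) v n| <= 2 * 2^-1 ^+ N.
Proof.
move=> hv N M; apply: le_trans (ler_norm_sum _ _ _) _.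
apply: le_trans (ler_sum _ (fun n _ => hv n)) _.
have [MN|NM] := leqP M N; first by rewrite big_geq // mulr_ge0 // exprn_ge0.
rewrite -(subnKC (ltnW NM)) geometric_partial_tail.
apply: le_trans (geometric_le_lim _ _ _ _) _ => //.
  by rewrite gtr0_norm //; lra.
have -> : 1 - 2^-1 = 2^-1 :> R by lra.
by rewrite invrK mulrC.
Qed.

Lemma dyadic_cvg v : (forall n, `|v n| <= 2^-1 ^+ n) -> cvgn (series v).
Proof.
move=> hv; apply: normed_cvg.
apply: (@series_le_cvg _ _ (geometric 1 2^-1)) => [n|n|n|] //=.
- by rewrite mul1r.
- by apply: is_cvg_geometric_series; rewrite gtr0_norm //; lra.
Qed.

Lemma dyadic_remainder v N : (forall n, `|v n| <= 2^-1 ^+ n) ->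
  `|limn (series v) - series v N| <= 2 * 2^-1 ^+ N.
Proof.
move=> hv; have cv := dyadic_cvg hv.
have cN : `|series v n - series v N| @[n --> \oo] -->
    `|limn (series v) - series v N|.
  by apply: cvg_norm; apply: cvgB => //; exact: cvg_cst.
apply: (cvgr_to_le cN); near=> n; rewrite sub_series_geq ?dyadic_tail //.
by near: n; exact: nbhs_infty_ge.
Unshelve. all: by end_near. Qed.

Lemma near_dyadic_small (e : R) : 0 < e -> exists N, 2 * 2^-1 ^+ N < e.
Proof.
move=> e0; have : (fun n => 2 * 2^-1 ^+ n) @ \oo --> (0 : R).
  rewrite -[X in _ --> X](mulr0 2); apply: cvgM; first exact: cvg_cst.
  by apply: cvg_expr; rewrite gtr0_norm //; lra.
move/cvgrPdist_lt => /(_ _ e0)[N _ /(_ N (leqnn N))] /=.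
rewrite sub0r normrN ger0_norm; first by exists N.
by rewrite mulr_ge0 // exprn_ge0.
Qed.

(** Tannery's theorem, with the dominating series fixed to the dyadic one. *)
Lemma dyadic_tannery (v : nat -> R^nat) l :
  (forall n j, `|v n j| <= 2^-1 ^+ n) -> (forall n, v n j @[j --> \oo] --> l n) ->
  \sum_(0 <= n < j) v n j @[j --> \oo] --> limn (series l).
Proof.
move=> hv vl.
have hl n : `|l n| <= 2^-1 ^+ n.
  apply: (cvgr_to_le (cvg_norm (vl n))).
  by near=> j; exact: hv.
apply/cvgrPdist_lt => e e0.
have [N Ne] : exists N, 2 * 2^-1 ^+ N < e / 3 by apply: near_dyadic_small; lra.
have : \sum_(0 <= n < N) v n j @[j --> \oo] --> \sum_(0 <= n < N) l n.
  elim: N {Ne} => [|N IHN].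
    under eq_fun do rewrite big_geq //.
    by rewrite big_geq //; exact: cvg_cst.
  under eq_fun do rewrite big_nat_recr //=.
  by rewrite big_nat_recr //=; exact: cvgD.
move=> /cvgrPdist_lt/(_ (e / 3)) => cN.
have {}cN := cN ltac:(lra).
near=> j.
have Nj : (N <= j)%N by near: j; exact: nbhs_infty_ge.
have h1 : `|\sum_(0 <= n < N) l n - \sum_(0 <= n < N) v n j| < e / 3.
  by near: j.
have h2 := dyadic_remainder N hl.
have h3 := dyadic_tail (hv^~ j) N j.
rewrite (@big_cat_nat _ _ _ N) //=.
set A := limn _ in h2 *; move: h1 h2 h3; rewrite /series /=.
set B := \sum_(_ <= _ < _) l _; set C := \sum_(_ <= _ < N) _; set D := \sum_(_ <= _ < _) _.
move=> h1 h2 h3; have -> : A - (C + D) = (A - B) + (B - C) - D by ring.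
have := ler_normB (A - B + (B - C)) D; have := ler_normD (A - B) (B - C).
by move: h1 h2 h3 Ne; lra.
Unshelve. all: by end_near. Qed.

End DyadicSeries.

(** * Closure properties of the Baire classes *)

Section BaireClasses.
Context {R : realType} {d : Order.disp_t} {W : orderType d}.
Hypothesis wfW : well_founded (fun a b : W => (a < b)%O).
Implicit Types (X : set R) (a b : W) (f g : R -> R).

Lemma least_or_greater b : (forall a, (b <= a)%O) \/ exists a, (a < b)%O.
Proof.
have [[a ab]|nb] := pselect (exists a, (a < b)%O); first by right; exists a.
by left=> a; rewrite leNgt; apply/negP => ab; apply: nb; exists a.
Qed.

Lemma baire_class_lt X a b f : (a < b)%O -> baire_class X a f -> baire_class X b f.
Proof.
move=> ab fa; apply: (@baire_lim _ _ _ X b (fun=> a) (fun=> f)) => // x _.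
exact: cvg_cst.
Qed.

Lemma baire_class_le X a b f : (a <= b)%O -> baire_class X a f -> baire_class X b f.
Proof. by rewrite le_eqVlt => /predU1P[->//|]; exact: baire_class_lt. Qed.

Lemma baire_class_within X b f : {within X, continuous f} -> baire_class X b f.
Proof.
move=> fc; elim/(well_founded_ind wfW): b => b IHb.
have [bmin|[a ab]] := least_or_greater b; first exact: baire_continuous.
exact: baire_class_lt ab (IHb _ ab).
Qed.

Lemma baire_class_cont X b f : continuous f -> baire_class X b f.
Proof. by move=> fc; apply: baire_class_within; exact: continuous_subspaceT. Qed.

Lemma baire_class_cst X b (c : R) : baire_class X b (fun=> c).
Proof. by apply: baire_class_cont => x; exact: cvg_cst. Qed.

Lemma baire_classP X b f : baire_class X b f ->
  ((forall a, (b <= a)%O) /\ {within X, continuous f}) \/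
  exists (a : nat -> W) (u : nat -> R -> R), [/\ forall n, (a n < b)%O,
    forall n, baire_class X (a n) (u n) &
    forall x, X x -> u n x @[n --> \oo] --> f x].
Proof.
by case=> {}b; [move=> {}f bmin fc; left | move=> a u {}f ? ? ?; right; exists a, u].
Qed.

Lemma baire_class_least X b f : (forall a, (b <= a)%O) ->
  baire_class X b f -> {within X, continuous f}.
Proof.
move=> bmin /baire_classP[[//]|[a [u [ab _ _]]]].
by have := bmin (a 0%N); rewrite leNgt ab.
Qed.

Lemma baire_class_lim X b f : (exists a, (a < b)%O) -> baire_class X b f ->
  exists (a : nat -> W) (u : nat -> R -> R), [/\ forall n, (a n < b)%O,
    forall n, baire_class X (a n) (u n) &
    forall x, X x -> u n x @[n --> \oo] --> f x].
Proof.
by case=> a ab /baire_classP[[bmin _]|//]; have := bmin a; rewrite leNgt ab.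
Qed.

(** The limit steps of f and g are merged by taking at each rank the larger of
the two classes. *)
Lemma baire_class_comp2 X b (h : R * R -> R) f g : continuous h ->
  baire_class X b f -> baire_class X b g -> baire_class X b (fun x => h (f x, g x)).
Proof.
move=> hc; elim/(well_founded_ind wfW): b f g => b IHb f g fb gb.
have [bmin|bgt] := least_or_greater b.
  apply: baire_continuous => // x.
  apply: (@continuous_comp (subspace X) _ _ (fun x => (f x, g x)) h); last exact: hc.
  have /(_ x) cf := @baire_class_least X b f bmin fb.
  have /(_ x) cg := @baire_class_least X b g bmin gb.
  exact: cvg_pair cf cg.
have [a1 [u1 [ab1 ub1 ul1]]] := baire_class_lim bgt fb.
have [a2 [u2 [ab2 ub2 ul2]]] := baire_class_lim bgt gb.
pose a n := Order.max (a1 n) (a2 n).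
have ab n : (a n < b)%O by rewrite gt_max ab1 ab2.
apply: (@baire_lim _ _ _ X b a (fun n x => h (u1 n x, u2 n x))) => // [n|x Xx].
  by apply: IHb => //; [apply: baire_class_le (ub1 n) | apply: baire_class_le (ub2 n)];
    rewrite le_max lexx ?orbT.
by apply: (cvg_comp (fun n => (u1 n x, u2 n x)) h (cvg_pair (ul1 x Xx) (ul2 x Xx))); exact: hc.
Qed.

Lemma baire_class_comp X b (h : R -> R) f : continuous h ->
  baire_class X b f -> baire_class X b (h \o f).
Proof.
move=> hc fb; apply: (@baire_class_comp2 X b (fun z => h z.1) f f) => // z.
by apply: continuous_comp; [exact: cvg_fst|exact: hc].
Qed.

Lemma baire_classD X b f g :
  baire_class X b f -> baire_class X b g -> baire_class X b (f \+ g).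
Proof. by apply: (@baire_class_comp2 X b (fun z => z.1 + z.2)); exact: add_continuous. Qed.

Lemma baire_classB X b f g :
  baire_class X b f -> baire_class X b g -> baire_class X b (f \- g).
Proof.
move=> fb gb; apply: (@baire_class_comp2 X b (fun z => z.1 - z.2)) => // z.
exact: cvgB cvg_fst cvg_snd.
Qed.

Lemma baire_classM X b f g :
  baire_class X b f -> baire_class X b g -> baire_class X b (f \* g).
Proof. by apply: (@baire_class_comp2 X b (fun z => z.1 * z.2)); exact: mul_continuous. Qed.

Lemma baire_class_sum X b (I : Type) (r : seq I) (F : I -> R -> R) :
  (forall i, baire_class X b (F i)) ->
  baire_class X b (fun x => \sum_(i <- r) F i x).
Proof.
move=> Fb; elim: r => [|i r IHr].
  by under eq_fun do rewrite big_nil; exact: baire_class_cst.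
by under eq_fun do rewrite big_cons; exact: baire_classD.
Qed.

Lemma baire_class_prod X b (I : Type) (r : seq I) (F : I -> R -> R) :
  (forall i, baire_class X b (F i)) ->
  baire_class X b (fun x => \prod_(i <- r) F i x).
Proof.
move=> Fb; elim: r => [|i r IHr].
  by under eq_fun do rewrite big_nil; exact: baire_class_cst.
by under eq_fun do rewrite big_cons; exact: baire_classM.
Qed.

Lemma baire_classX X b f n : baire_class X b f -> baire_class X b (fun x => f x ^+ n).
Proof.
move=> fb; exact: (@baire_class_comp X b (fun z => z ^+ n) f (@exprn_continuous R n) fb).
Qed.

Lemma baire_class_lt_sum X b (f : nat -> R -> R) :
  (exists a, (a < b)%O) ->
  (forall n, exists2 a, (a < b)%O & baire_class X a (f n)) ->
  forall N, exists2 a, (a < b)%O & baire_class X a (fun x => \sum_(0 <= n < N) f n x).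
Proof.
move=> [a0 a0b] fb; elim=> [|N [a ab IHN]].
  exists a0 => //; under eq_fun do rewrite big_geq //.
  exact: baire_class_cst.
have [a' a'b fa'] := fb N; exists (Order.max a a'); first by rewrite gt_max ab.
under eq_fun do rewrite big_nat_recr //=.
by apply: baire_classD; [apply: baire_class_le IHN|apply: baire_class_le fa'];
  rewrite le_max lexx ?orbT.
Qed.

Lemma baire_class_seqlim X b (u : nat -> R -> R) f :
  (forall n, exists2 a, (a < b)%O & baire_class X a (u n)) ->
  (forall x, X x -> u n x @[n --> \oo] --> f x) -> baire_class X b f.
Proof.
move=> ub uf; pose a n := sval (cid2 (ub n)).
apply: (@baire_lim _ _ _ X b a u) => // n.
  by rewrite /a; case: cid2.
by rewrite /a; case: cid2.
Qed.

Definition clamp (e x : R) := Num.max (- e) (Num.min e x).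

Lemma clamp_continuous e : continuous (clamp e).
Proof.
apply: (@max_fun_continuous _ R R (fun=> - e) (fun x => Num.min e x)).
  by move=> x; exact: cvg_cst.
by apply: (@min_fun_continuous _ R R (fun=> e) id) => x; [exact: cvg_cst|exact: cvg_id].
Qed.

Lemma norm_clamp_le e x : 0 <= e -> `|clamp e x| <= e.
Proof.
move=> e0; rewrite ler_norml /clamp le_max lexx /= ge_max ge_min lexx /= andbT.
by lra.
Qed.

Lemma clamp_id e x : `|x| <= e -> clamp e x = x.
Proof. by rewrite ler_norml => /andP[? ?]; rewrite /clamp min_r // max_r. Qed.

(** Baire classes are closed under uniform limits, in the form of series with a
dyadic bound. Above the least class, the approximations of the terms are clamped
to the same bound, and the partial sums taken along the diagonal converge by
Tannery's theorem; without the clamp they need not converge. *)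
Lemma baire_class_dyadic_series X b (f : nat -> R -> R) :
  (forall n, baire_class X b (f n)) -> (forall n x, `|f n x| <= 2^-1 ^+ n) ->
  baire_class X b (fun x => limn (series (fun n => f n x))).
Proof.
move=> fb hf; have [bmin|bgt] := least_or_greater b.
  apply: baire_continuous => // x.
  apply/cvgrPdist_lt => e e0.
  have [N Ne] : exists N, 2 * 2^-1 ^+ N < e / 3 by apply: near_dyadic_small; lra.
  have : {within X, continuous (fun y => \sum_(0 <= n < N) f n y)}.
    apply: (@baire_class_least X b) => //.
    exact: baire_class_sum.
  move=> /(_ x)/cvgrPdist_lt/(_ (e / 3) ltac:(lra)) cN.
  near=> y.
  have h1 : `|\sum_(0 <= n < N) f n x - \sum_(0 <= n < N) f n y| < e / 3 by near: y.
  have h2 := dyadic_remainder N (hf^~ x); have h3 := dyadic_remainder N (hf^~ y).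
  move: h2 h3 h1; rewrite /series /=.
  set A := lim _; set A' := \sum_(_ <= _ < _) _; set B := lim _ => h2.
  set B' := \sum_(_ <= _ < _) _ => h3 h1.
  have -> : A - B = (A - A') + (A' - B') - (B - B') by ring.
  have := ler_normB (A - A' + (A' - B')) (B - B').
  have := ler_normD (A - A') (A' - B').
  by move: h1 h2 h3 Ne; lra.
pose e n : R := 2^-1 ^+ n.
pose a n := sval (cid (baire_class_lim bgt (fb n))).
pose u n := sval (cid (svalP (cid (baire_class_lim bgt (fb n))))).
have uP n : [/\ forall k, (a n k < b)%O,
    forall k, baire_class X (a n k) (u n k) &
    forall x, X x -> u n k x @[k --> \oo] --> f n x].
  exact: svalP (cid (svalP (cid (baire_class_lim bgt (fb n))))).
apply: (@baire_class_seqlim X b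
  (fun j x => \sum_(0 <= n < j) clamp (e n) (u n j x))).
  move=> j; apply: (@baire_class_lt_sum X b (fun n x => clamp (e n) (u n j x))) => // n.
  exists (a n j); first by have [] := uP n.
  by apply: baire_class_comp; [exact: clamp_continuous|have [] := uP n].
move=> x Xx; apply: dyadic_tannery => [n j|n].
  by rewrite norm_clamp_le // exprn_ge0.
rewrite -(clamp_id (hf n x)); have [_ _ /(_ x Xx) ul] := uP n.
exact: (cvg_comp (fun j => u n j x) (clamp (e n)) ul (@clamp_continuous (e n) (f n x))).
Unshelve. all: by end_near. Qed.

End BaireClasses.

(** * Positivity sets of functions of a Baire class *)

Section UniversalFunctions.
Context {R : realType} {d : Order.disp_t} {W : orderType d}.
Hypothesis hW : omega1_segment W.
Let wfW := hW.1.
Implicit Types (X : set R) (a b : W) (f g : R -> R).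

Definition ramp (e x : R) := Num.max 0 (Num.min e x).

Lemma ramp_continuous e : continuous (ramp e).
Proof.
apply: (@max_fun_continuous _ R R (fun=> 0) (fun x => Num.min e x)).
  by move=> x; exact: cvg_cst.
by apply: (@min_fun_continuous _ R R (fun=> e) id) => x; [exact: cvg_cst|exact: cvg_id].
Qed.

Lemma ramp_ge0 e x : 0 <= ramp e x.
Proof. by rewrite le_max lexx. Qed.

Lemma norm_ramp_le e x : 0 <= e -> `|ramp e x| <= e.
Proof. by move=> e0; rewrite ger0_norm ?ramp_ge0 // ge_max e0 ge_min lexx. Qed.

Lemma ramp_gt0 e x : 0 < e -> (0 < ramp e x) = (0 < x).
Proof. by move=> e0; rewrite lt_max ltxx lt_min e0. Qed.

Lemma ramp_eq0 e x : x <= 0 -> ramp e x = 0.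
Proof. by move=> x0; apply: max_l; rewrite ge_min x0 orbT. Qed.

Lemma ramp_sat e x : 0 <= e -> e <= x -> ramp e x = e.
Proof. by move=> e0 ex; rewrite /ramp min_l // max_r. Qed.

(** Families are indexed by countable types; the padding by 0 at the naturals
that encode no index leaves the set where some term is positive unchanged. *)
Definition enum_fun (I : countType) (f : I -> R -> R) (n : nat) : R -> R :=
  if unpickle n is Some i then f i else fun=> 0.

Lemma enum_fun_gt0 (I : countType) (f : I -> R -> R) x :
  (exists n, 0 < enum_fun f n x) <-> (exists i, 0 < f i x).
Proof.
split=> [[n]|[i fi]]; last by exists (pickle i); rewrite /enum_fun pickleK.
by rewrite /enum_fun; case: (unpickle n) => [i|]; [exists i|rewrite ltxx].
Qed.

(** The sets {f > 0} with f of class b play the role of an additive Borel class: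
they are closed under countable unions, since a uniformly convergent series of
nonnegative ramps is positive exactly where one of its terms is. *)
Lemma baire_class_exists_gt0 X b (I : countType) (f : I -> R -> R) :
  (forall i, baire_class X b (f i)) ->
  exists2 g, baire_class X b g & forall x, 0 < g x <-> exists i, 0 < f i x.
Proof.
move=> fb; pose h n x := ramp (2^-1 ^+ n) (enum_fun f n x).
have hb n : baire_class X b (h n).
  apply: baire_class_comp => //; first exact: ramp_continuous.
  by rewrite /enum_fun; case: (unpickle n) => [i//|]; exact: baire_class_cst.
have e0 n : 0 < 2^-1 ^+ n :> R by rewrite exprn_gt0.
have h1 n x : `|h n x| <= 2^-1 ^+ n by rewrite norm_ramp_le // ltW.
exists (fun x => limn (series (fun n => h n x))).
  exact: baire_class_dyadic_series.
move=> x; rewrite -enum_fun_gt0; split=> [g0|[n fn]].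
  apply: contrapT => /forallNP f0; move: g0.
  suff -> : series (fun n => h n x) = fun=> 0 by rewrite lim_cst // ltxx.
  apply/funext => n; rewrite /series /= big1 // => i _.
  by apply: ramp_eq0; rewrite leNgt; apply/negP.
have hn : 0 < h n x by rewrite ramp_gt0.
have hcvg := dyadic_cvg (h1^~ x).
have hnd : nondecreasing_seq (series (fun n => h n x)).
  by apply: nondecreasing_series => i _ _; exact: ramp_ge0.
apply: lt_le_trans (nondecreasing_cvgn_le hnd hcvg n.+1).
rewrite /series /= big_nat_recr //= ltr_wpDl // sumr_ge0 // => i _.
exact: ramp_ge0.
Qed.

(** Multiplying the K-th partial sum of ramps by K and truncating at 1 gives in
the limit the indicator of the union. It costs a single limit, however close to
b the classes of the f i come; this is what makes the successor and limit
cases of the hierarchy uniform. *)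
Lemma baire_class_indic_gt0 X b (I : countType) (f : I -> R -> R) :
  (exists a, (a < b)%O) ->
  (forall i, exists2 a, (a < b)%O & baire_class X a (f i)) ->
  baire_class X b \1_[set x | exists i, 0 < f i x].
Proof.
move=> bgt fb; pose h K n x := K%:R * ramp 1 (enum_fun f n x).
have hb K n : exists2 a, (a < b)%O & baire_class X a (h K n).
  have [a ab fa] : exists2 a, (a < b)%O & baire_class X a (enum_fun f n).
    rewrite /enum_fun; case: (unpickle n) => [i//|].
    by case: bgt => a ab; exists a => //; exact: baire_class_cst.
  exists a => //; apply: (@baire_class_comp _ _ _ wfW X a (fun y => K%:R * ramp 1 y)) fa.
  by move=> y; apply: cvgM; [exact: cvg_cst|exact: ramp_continuous].
apply: (@baire_class_seqlim _ _ _ X b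
  (fun K x => ramp 1 (\sum_(0 <= n < K) h K n x))).
  move=> K; have [a ab ha] := baire_class_lt_sum wfW bgt (hb K) K.
  by exists a => //; apply: baire_class_comp ha => //; exact: ramp_continuous.
move=> x Xx; apply: cvg_near_cst.
rewrite indicE; have [fx|fx] := pselect (exists i, 0 < f i x).
  rewrite mem_set //; have /enum_fun_gt0[n fn] := fx.
  set r := ramp 1 (enum_fun f n x).
  have r0 : 0 < r by rewrite ramp_gt0.
  near=> K; apply: ramp_sat => //.
  have Kr : r^-1 <= K%:R by near: K; exact: nbhs_infty_ger.
  have nK : (n < K)%N by near: K; exact: nbhs_infty_gt.
  rewrite big_mkord (bigD1 (Ordinal nK)) //= ler_wpDr //.
    by apply: sumr_ge0 => i _; rewrite mulr_ge0 // ramp_ge0.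
  by rewrite -(mulVf (lt0r_neq0 r0)) ler_pM2r.
rewrite memNset //; near=> K; rewrite big1 ?ramp_eq0 // => n _.
rewrite /h ramp_eq0 ?mulr0 // leNgt; apply: contra_notN fx => fn.
by apply/enum_fun_gt0; exists n.
Unshelve. all: by end_near. Qed.

(** This is where the countability of the initial segments is used: countably
many levels can be handled by one countable operation. *)
Lemma enum_below b : (exists a, (a < b)%O) ->
  exists e : nat -> W, (forall i, (e i < b)%O) /\
    forall a, (a < b)%O -> exists i, e i = a.
Proof.
move=> [a0 a0b].
have [phi phiI] : exists phi : W -> nat, {in [set a | (a < b)%O] &, injective phi}.
  exact/countable_injP/hW.2.
have /choice[e eP] i : exists a, (a < b)%O /\
    forall a', (a' < b)%O -> phi a' = i -> a = a'.
  have [[a [ab <-]]|no] := pselect (exists a, (a < b)%O /\ phi a = i).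
    by exists a; split=> // a' a'b /phiI ->//; rewrite inE.
  by exists a0; split=> // a' a'b ia; case: no; exists a'.
exists e; split=> [i|a ab]; first by case: (eP i).
by exists (phi a); case: (eP (phi a)) => _; apply.
Qed.

Definition rat_ball (q : rat * nat) (x : R) : R := q.2.+1%:R^-1 - `|x - ratr q.1|.

Lemma rat_ball_continuous q : continuous (rat_ball q).
Proof.
move=> x; apply: cvgB; first exact: cvg_cst.
by apply: cvg_norm; apply: cvgB; [exact: cvg_id|exact: cvg_cst].
Qed.

Lemma rat_ball_basis (x e : R) : 0 < e ->
  exists q, 0 < rat_ball q x /\ forall y, 0 < rat_ball q y -> `|x - y| < e.
Proof.
move=> e0; have [n _ /(_ n (leqnn n)) /=] := near_infty_natSinv_lt (PosNum (divr_gt0 e0 (ltr0n R 2))).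
have : 0 < n.+1%:R^-1 :> R by rewrite invr_gt0.
set r : R := n.+1%:R^-1 => r0 re.
have [q] : exists q, ratr q \in `]x - r, x + r[ by apply: rat_in_itvoo; lra.
rewrite in_itv /= => /andP[xq qx].
exists (q, n); rewrite /rat_ball /= -/r; split.
  by rewrite subr_gt0 ltr_distlC; apply/andP; split; lra.
move=> y; rewrite subr_gt0 !ltr_distlC => /andP[y1 y2].
by apply/andP; split; lra.
Qed.

End UniversalFunctions.

(** * Universal relations *)

Section Universal.
Context {R : realType} {d : Order.disp_t} {W : orderType d}.
Hypothesis hW : omega1_segment W.
Let wfW := hW.1.
Implicit Types (X : set R) (a b : W) (f g : R -> R).

(** U parametrizes, by codes s, the traces on X of the sets {f > 0} with f of
class b. The second clause bounds the complexity of U itself: it is what the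
diagonal {x | U (code x) x} needs. Codes are read off from the signs of
continuous functions since the line carries no nonconstant continuous map to
the space of subsets of nat. *)
Definition universal b (U : set nat -> R -> Prop) :=
  (forall X f, baire_class X b f ->
    exists s, forall x, X x -> U s x <-> 0 < f x) /\
  (forall sigma : nat -> R -> R, (forall m, continuous (sigma m)) ->
    exists2 f, baire_class setT b f &
      forall x, U [set m | 0 < sigma m x] x <-> 0 < f x).

Lemma mem_pickle_image (I : countType) (P : set I) i :
  (pickle @` P) (pickle i) <-> P i.
Proof.
by split=> [[j Pj /(pcan_inj pickleK) <-]|Pi] //; exists i.
Qed.

(** For continuous f, {f > 0} is a union of rational balls, and a code is the list
of the balls to be used. *)
Lemma universal_least b : (forall a, (b <= a)%O) -> exists U, universal b U.
Proof.
move=> bmin.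
exists (fun s x => exists q : rat * nat, s (pickle q) /\ 0 < rat_ball q x); split.
  move=> X f /(baire_class_least bmin) fc.
  exists (pickle @` [set q | forall y, X y -> 0 < rat_ball q y -> 0 < f y]) => x Xx.
  split=> [[q [/mem_pickle_image + qx]]|fx]; first exact.
  have [e e0 He] : exists2 e : R, 0 < e & forall y, X y -> `|x - y| < e -> 0 < f y.
    have : f y @[y --> within X (nbhs x)] --> f x.
      have /(_ x) := fc; rewrite /prop_for /continuous_at.
      by rewrite /from_subspace (nbhs_subspace_in Xx).
    move=> /(@cvgr_gt _ _ _ _ _ _) /(_ 0 fx).
    rewrite near_withinE => /nbhs_ballP[e /= e0 He].
    by exists e => // y Xy xy; apply: He.
  have [q [qx qe]] := rat_ball_basis x e0.
  exists q; split=> //; apply/mem_pickle_image => y Xy qy.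
  by apply: He => //; exact: qe.
move=> sigma sc.
have [q|f fb fP] := @baire_class_exists_gt0 _ _ _ hW setT b _
  (fun (q : rat * nat) x => Num.min (sigma (pickle q) x) (rat_ball q x)).
  apply: baire_class_cont => //.
  by apply: (@min_fun_continuous _ R R (sigma (pickle q)) (rat_ball q));
    [exact: sc|exact: rat_ball_continuous].
exists f => // x; rewrite fP; split=> -[q].
  by case=> /= ? ?; exists q; rewrite lt_min; apply/andP.
by rewrite lt_min => /andP[? ?]; exists q.
Qed.

(** If f = lim u_j then f > 0 iff for some M and K, u_j >= 1 / (M + 1) for all
j >= K: a countable union of countable intersections of complements of sets
{g > 0} of lower classes. So a code for f packs, for each (M, K) and each j,
codes for these lower sets at every level e i; a code of the empty set is used
when i is not the index chosen for the class of u_j, or when j < K. *)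
Lemma universal_greater b : (exists a, (a < b)%O) ->
  (forall a, (a < b)%O -> exists U, universal a U) -> exists U, universal b U.
Proof.
move=> bgt IHb; have [e [eb esurj]] := enum_below hW bgt.
have /choice[V VP] i := IHb (e i) (eb i).
pose sub (s : set nat) (N j : nat * nat) : set nat :=
  [set m | s (pickle ((N, j), m))].
exists (fun s x => exists N : nat * nat, forall j : nat * nat,
  ~ V j.2 (sub s N j) x); split.
  move=> X f /(baire_class_lim bgt)[a [u [ab ub uf]]].
  have /choice[iota iotaP] n : exists i, e i = a n by apply: esurj.
  pose C (N j : nat * nat) := (iota j.1 == j.2) && (N.2 <= j.1)%N.
  have /choice[t tP] : forall (Nj : (nat * nat) * (nat * nat)), exists s : set nat,
      forall x, X x -> V Nj.2.2 s x <->
        (C Nj.1 Nj.2 /\ 0 < Nj.1.1.+1%:R^-1 - u Nj.2.1 x).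
    case=> N [j i] /=; have [/andP[/= /eqP ij Nj]|nC] := boolP (C N (j, i)).
      have [VU _] := VP i.
      have [|s sP] := VU X (fun x => N.1.+1%:R^-1 - u j x).
        apply: (@baire_classB _ _ _ wfW _ _ (fun=> N.1.+1%:R^-1)).
          exact: baire_class_cst.
        by rewrite -ij iotaP.
      by exists s => x Xx; rewrite sP //; split=> [//|[]].
    have [VU _] := VP i; have [|s sP] := VU X (fun=> 0); first exact: baire_class_cst.
    by exists s => x Xx; rewrite sP // ltxx; split=> // -[].
  (* A code of U is a single subset of nat: the triples are packed into it. *)
  exists (pickle @` [set q | t q.1 q.2]) => x Xx.
  have subE N j : sub (pickle @` [set q | t q.1 q.2]) N j = t (N, j).
    by apply/seteqP; split=> m; rewrite /sub /=;
      [move/mem_pickle_image | move=> tm; apply/mem_pickle_image].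
  split=> [[N NP]|fx].
    have N0 : 0 < N.1.+1%:R^-1 :> R by rewrite invr_gt0.
    apply: lt_le_trans N0 _.
    apply: (cvgr_to_ge (uf x Xx)); near=> n.
    rewrite leNgt; apply/negP => un; apply: (NP (n, iota n)).
    rewrite subE; apply/(tP (N, (n, iota n))) => //=; split; last by rewrite subr_gt0.
    by rewrite /C /= eqxx; near: n; exact: nbhs_infty_ge.
  have f20 : 0 < f x / 2 by rewrite divr_gt0.
  have [M _ /(_ M (leqnn M)) /= Mf] := near_infty_natSinv_lt (PosNum f20).
  have /cvgr_gt /(_ (f x / 2)) := uf x Xx.
  move=> /(_ ltac:(lra)) [K _ HK].
  exists (M, K) => -[j i]; rewrite subE => /(tP ((M, K), (j, i)) x Xx)[/andP[/= _ Kj]].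
  rewrite subr_gt0 => uM; have := lt_trans (lt_trans (HK j Kj) uM) Mf.
  by rewrite ltxx.
move=> sigma sc.
have /choice[f fP] (Nj : (nat * nat) * (nat * nat)) : exists f,
    baire_class setT (e Nj.2.2) f /\ forall x,
      V Nj.2.2 (sub [set m | 0 < sigma m x] Nj.1 Nj.2) x <-> 0 < f x.
  have [_ /(_ (fun m => sigma (pickle (Nj, m))))[//|f fb fV]] := VP Nj.2.2.
  by exists f; split=> // x; rewrite -fV /sub /= -surjective_pairing.
(* The indicator of the intersection over j, already of class b. *)
pose g N x : R := 1 - \1_[set x | exists j, 0 < f (N, j) x] x.
have [N|h hb hg] := @baire_class_exists_gt0 _ _ _ hW setT b _ g.
  apply: (@baire_classB _ _ _ wfW _ _ (fun=> 1)); first exact: baire_class_cst.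
  apply: baire_class_indic_gt0 => // j.
  by exists (e j.2) => //; have [] := fP (N, j).
exists h => // x; rewrite hg.
have gP N : 0 < g N x <-> forall j, ~ (0 < f (N, j) x).
  rewrite /g indicE; have [fx|fx] := pselect (exists j, 0 < f (N, j) x).
    rewrite mem_set // subrr ltxx; split=> // H.
    by case: fx => j /H.
  rewrite memNset // subr0 ltr01; split=> // _ j fj; apply: fx.
  by exists j.
split=> -[N NP]; exists N.
  by apply/gP => j fj; apply: (NP j); apply/(fP (N, j)).2.
by move=> j; move/gP: NP => /(_ j); apply: contra_not => /(fP (N, j)).2.
Unshelve. all: by end_near. Qed.

Lemma exists_universal b : exists U, universal b U.
Proof.
elim/(well_founded_ind wfW): b => b IHb.
have [bmin|bgt] := least_or_greater b; first exact: universal_least.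
exact: universal_greater.
Qed.

End Universal.

(** * Decimal codes and the diagonal argument *)

Section Digits.
Context {R : realType}.
Implicit Types (x y : R).

Fixpoint prefix_value (dg : nat -> nat) (m : nat) : nat :=
  if m is m'.+1 then (10 * prefix_value dg m' + dg m')%N else 0%N.

(** The integer part k of 10^m x vanishes for m = 0, that is, x lies in the unit
interval. *)
Lemma decimal_expansion (dg : nat -> nat) : (forall m, dg m < 10)%N ->
  exists x : R, forall m, exists k : nat,
    (k%:R + (dg m)%:R / 10 <= 10 ^+ m * x <= k%:R + (dg m).+1%:R / 10) /\
    (m = 0%N -> k = 0%N).
Proof.
move=> dg10; pose k := prefix_value dg.
pose lo m : R := (k m)%:R / 10 ^+ m; pose hi m : R := (k m).+1%:R / 10 ^+ m.
have e0 m : 0 < 10 ^+ m :> R by rewrite exprn_gt0.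
have lo_nd : nondecreasing_seq lo.
  apply/nondecreasing_seqP => m; rewrite /lo exprS invfM mulrA.
  rewrite ler_pM2r ?invr_gt0 // ler_pdivlMr // -natrM ler_nat /= mulnC.
  exact: leq_addr.
have hi_ni : nonincreasing_seq hi.
  apply/nonincreasing_seqP => m; rewrite /hi exprS invfM mulrA.
  rewrite ler_pM2r ?invr_gt0 // ler_pdivrMr // -natrM ler_nat /=.
  by rewrite mulSnr [(k m * 10)%N]mulnC -addnS leq_add2l dg10.
have lohi m n : lo m <= hi n.
  apply: le_trans (lo_nd _ _ (leq_maxl m n)) _.
  apply: le_trans _ (hi_ni _ _ (leq_maxr m n)).
  by rewrite ler_pM2r ?invr_gt0 // ler_nat.
have lo_cvg : cvgn lo.
  by apply: nondecreasing_is_cvgn => //; exists (hi 0%N) => _ [m _ <-].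
exists (limn lo) => m; exists (k m); split; last by move=> ->.
have lox : lo m.+1 <= limn lo by exact: nondecreasing_cvgn_le.
have xhi : limn lo <= hi m.+1 by apply: limr_le => //; near=> n.
move: lox xhi; rewrite /lo /hi /= exprS invfM mulrA => lox xhi.
have kE (i : nat) : (k m)%:R + i%:R / 10 = (10 * k m + i)%:R / 10 :> R.
  by rewrite natrD natrM mulrDl mulrAC mulfV ?mul1r // pnatr_eq0.
rewrite !kE addnS [10 ^+ m * _]mulrC; apply/andP; split.
  by rewrite -ler_pdivrMr.
by rewrite -ler_pdivlMr // -mulrA.
Unshelve. all: by end_near. Qed.

(** On a half period the wave is decreasing, so its values tell apart the digits
0 to 4 continuously and independently of the integer part. *)
Definition wave x : R := cos (pi *+ 2 * x).

Lemma wave_continuous : continuous wave.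
Proof.
move=> x; apply: (continuous_comp (f := fun x => pi *+ 2 * x) (g := cos)).
  by apply: cvgM; [exact: cvg_cst|exact: cvg_id].
exact: continuous_cos.
Qed.

Lemma waveDz x (z : int) : wave (z%:~R + x) = wave x.
Proof.
have waveDn n y : wave (n%:R + y) = wave y.
  elim: n => [|n IHn]; first by rewrite add0r.
  by rewrite -natr1 addrAC /wave mulrDr mulr1 cosD2pi.
case: z => n; first by rewrite -pmulrn waveDn.
by rewrite NegzE mulrNz -pmulrn -[LHS](waveDn n.+1) addNKr.
Qed.

(** The value of the wave at the left end of digit j. The digits in use are 0 (the
tag), 2 (bit one) and 4 (bit zero): gaps separate their closed ranges. *)
Definition level (j : nat) : R := wave (j%:R / 10).

Lemma wave_lt x y : 0 <= x <= 2^-1 -> 0 <= y <= 2^-1 -> (wave y < wave x) = (x < y).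
Proof.
have pi0 := @pi_gt0 R.
have itv (z : R) : 0 <= z <= 2^-1 -> pi *+ 2 * z \in `[0, pi]%R.
  move=> /andP[z0 z2]; rewrite in_itv /= mulr2n.
  have h1 : 0 <= pi * z by apply: mulr_ge0; lra.
  have h2 : 0 <= pi * (1 - 2 * z) by apply: mulr_ge0; lra.
  by apply/andP; split; move: h1 h2; lra.
move=> /itv x2 /itv y2; rewrite /wave (ltr_cos x2 y2).
by rewrite ltr_pM2l // mulr2n addr_gt0.
Qed.

Lemma wave_le x y : 0 <= x -> x <= y -> y <= 2^-1 -> wave y <= wave x.
Proof. by move=> x0 xy y2; rewrite leNgt wave_lt -?leNgt //; lra. Qed.

Lemma level_lt i j : (i < j <= 5)%N -> level j < level i.
Proof.
move=> /andP[ij j5]; have i0 : 0 <= i%:R :> R by [].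
have ij' : i%:R < j%:R :> R by rewrite ltr_nat.
have j5' : j%:R <= 5 :> R by rewrite ler_nat.
by rewrite wave_lt; lra.
Qed.

Lemma wave_digit y (z : int) j : (j < 5)%N ->
  z%:~R + j%:R / 10 <= y <= z%:~R + j.+1%:R / 10 ->
  level j.+1 <= wave y <= level j.
Proof.
move=> j5 /andP[zy yz]; have -> : y = z%:~R + (y - z%:~R) by rewrite addrC subrK.
rewrite waveDz; have j0 : 0 <= j%:R :> R by [].
have : j.+1%:R <= 5 :> R by rewrite ler_nat.
rewrite -(natr1 j) in yz * => j1.
by apply/andP; split; apply: wave_le; rewrite -?(natr1 j); lra.
Qed.

(** The digit after position p is the tag 0; the following ones are 2 or 4
according to s. *)
Lemma coded_point (p : nat) (k : int) (s : set nat) : exists x,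
  [/\ k%:~R / 10 ^+ p <= x <= (k + 1)%:~R / 10 ^+ p,
      level 1 <= wave (10 ^+ p * x),
      forall m, wave (10 ^+ (p + m.+1) * x) <= level 2 &
      forall m, s m <-> level 4 < wave (10 ^+ (p + m.+1) * x)].
Proof.
pose dg m := if m is m'.+1 then if `[< s m' >] then 2%N else 4%N else 0%N.
have dg5 m : (dg m < 5)%N by case: m => //= m; case: ifP.
have [|t tP] := @decimal_expansion dg.
  by move=> m; exact: leq_trans (dg5 m) _.
have e0 m : 0 < 10 ^+ m :> R by rewrite exprn_gt0.
exists ((k%:~R + t) / 10 ^+ p).
have scale m : 10 ^+ (p + m) * ((k%:~R + t) / 10 ^+ p) = 10 ^+ m * k%:~R + 10 ^+ m * t.
  by rewrite exprD [10 ^+ p * _]mulrC -mulrA [10 ^+ p * _]mulrC divfK ?gt_eqF // mulrDr.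
have wv m : level (dg m).+1 <= wave (10 ^+ (p + m) * ((k%:~R + t) / 10 ^+ p)) <= level (dg m).
  have [z [/andP[zt tz] _]] := tP m.
  apply: (@wave_digit _ (10 ^+ m * k + z%:Z)) => //; rewrite scale.
  rewrite rmorphD rmorphM rmorphXn /= -pmulrn.
  by apply/andP; split; lra.
split.
- have [z [zt /(_ erefl) z0]] := tP 0%N; move: zt.
  rewrite z0 /= expr0 mul1r => /andP[t0 t1].
  by rewrite !ler_pM2r ?invr_gt0 // rmorphD /=; apply/andP; split; lra.
- by have := wv 0%N; rewrite addn0 => /andP[].
- move=> m; have /andP[_ /le_trans] := wv m.+1; apply.
  by rewrite /=; case: ifP => // _; rewrite ltW // level_lt.
- move=> m; have := wv m.+1; rewrite /=; case: asboolP => sm /andP[w1 w2].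
    by split=> // _; apply: lt_le_trans w1; rewrite level_lt.
  by split=> // /lt_le_trans/(_ w2); rewrite ltxx.
Qed.

Definition code_bit (p m : nat) x : R := wave (10 ^+ (p + m.+1) * x) - level 4.

Definition code x p : set nat := [set m | 0 < code_bit p m x].

Definition tagged_set p : set R := [set x | level 1 <= wave (10 ^+ p * x) /\
  forall m, wave (10 ^+ (p + m.+1) * x) <= level 2].

Lemma wave_scale_continuous (c : R) : continuous (fun x => wave (c * x)).
Proof.
move=> x; apply: (continuous_comp (f := fun x => c * x) (g := wave)).
  by apply: cvgM; [exact: cvg_cst|exact: cvg_id].
exact: wave_continuous.
Qed.

Lemma code_bit_continuous p m : continuous (code_bit p m).
Proof.
by move=> x; apply: cvgB; [exact: wave_scale_continuous|exact: cvg_cst].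
Qed.

(** The later of two tags would also have to be a bit of the earlier code. *)
Lemma tagged_set_disjoint p q x : tagged_set p x -> tagged_set q x -> p = q.
Proof.
wlog pq : p q / (p < q)%N.
  move=> H px qx; have [pq|qp|//] := ltngtP p q; first exact: H.
  by apply/esym; exact: H.
have qE : (p + (q - p).-1.+1)%N = q by rewrite prednK ?subn_gt0 // subnKC // ltnW.
move=> [_ /(_ (q - p).-1)]; rewrite qE => w2 [w1 _].
have := le_trans w1 w2; rewrite leNgt.
by rewrite (@level_lt 1 2).
Qed.

(** The closed set [tagged_set p] is where none of these continuous functions is
positive. *)
Definition tag_excess p (o : option nat) x : R :=
  if o is Some m then wave (10 ^+ (p + m.+1) * x) - level 2
  else level 1 - wave (10 ^+ p * x).

Lemma tagged_setE p x : tagged_set p x <-> ~ exists o, 0 < tag_excess p o x.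
Proof.
split=> [[w1 w2] [[m|]]|H]; rewrite /= ?subr_gt0.
- by rewrite ltNge w2.
- by rewrite ltNge w1.
- split=> [|m]; rewrite leNgt; apply/negP => w; apply: H.
    by exists None; rewrite subr_gt0.
  by exists (Some m); rewrite subr_gt0.
Qed.

Lemma tag_excess_continuous p o : continuous (tag_excess p o).
Proof.
by case: o => [m|] x; apply: cvgB => /=;
  first [exact: wave_scale_continuous | exact: cvg_cst].
Qed.

End Digits.

Section Diagonal.
Context {R : realType} {d : Order.disp_t} {W : orderType d}.
Hypothesis hW : omega1_segment W.
Let wfW := hW.1.
Implicit Types (X : set R) (a b : W) (U : set nat -> R -> Prop).

Definition diagonal_set U p : set R := tagged_set p `&` [set x | U (code x p) x].

Lemma diagonal_set_class a b U p : (a < b)%O -> universal a U ->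
  baire_class setT b (\1_(diagonal_set U p) : R -> R).
Proof.
move=> ab [_ /(_ (code_bit p))[|f fa fU]]; first exact: code_bit_continuous.
have bgt : exists a, (a < b)%O by exists a.
have tb := @baire_class_indic_gt0 R _ W hW setT b _ (tag_excess p) bgt.
have {}tb := tb (fun o => ex_intro2 _ _ a ab
  (@baire_class_cont _ _ _ wfW _ _ _ (@tag_excess_continuous _ p o))).
have ub := @baire_class_indic_gt0 R _ W hW setT b unit (fun=> f) bgt.
have {}ub := ub (fun=> ex_intro2 _ _ a ab fa).
have -> : (\1_(diagonal_set U p) : R -> R) = (fun x =>
    (1 - \1_[set x | exists o, 0 < tag_excess p o x] x) *
    \1_[set x | exists _ : unit, 0 < f x] x).
  apply/funext => x; rewrite !indicE.
  have [tx|tx] := pselect (tagged_set p x); last first.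
    rewrite memNset; last by case.
    rewrite mem_set; first by rewrite subrr mul0r.
    by apply: contrapT => /tagged_setE.
  rewrite [x \in [set x | exists o, _]]memNset; last exact/tagged_setE.
  rewrite subr0 mul1r; congr (nat_of_bool _)%:R.
  apply/idP/idP; rewrite !inE.
    by move=> [_ /fU fx]; exists tt.
  by move=> [_ fx]; split=> //; apply/fU.
apply: (@baire_classM _ _ _ wfW _ _ (fun x => 1 - _)) => //.
apply: (@baire_classB _ _ _ wfW _ _ (fun=> 1)) => //.
exact: baire_class_cst.
Qed.

(** Suppose that F = c 1_D on the tagged points of X. The set {|F / c| < 1/2}
has a code s as F is of class a. At a tagged point x of X whose own code is
s, membership in D is equivalent to U s x, that is to |F x / c| < 1/2, that
is to x not being in D. *)
Lemma diagonal_set_neq a U p (k : int) X (F : R -> R) (c : R) :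
  universal a U -> baire_class X a F -> c != 0 ->
  (forall x, k%:~R / 10 ^+ p <= x <= (k + 1)%:~R / 10 ^+ p -> X x) ->
  exists x, [/\ X x, tagged_set p x & F x != c * \1_(diagonal_set U p) x].
Proof.
move=> [/(_ X (fun x => 2^-1 - `|c^-1 * F x|)) + _] Fa c0 kX.
case.
  apply: (@baire_classB _ _ _ wfW _ _ (fun=> 2^-1)); first exact: baire_class_cst.
  apply: (@baire_class_comp _ _ _ wfW _ _ (fun y => `|c^-1 * y|)) => // y.
  apply: cvg_norm; apply: cvgM; first exact: cvg_cst.
  exact: cvg_id.
move=> s sP; have [x [kx t1 t2 sx]] := @coded_point R p k s.
exists x; split; [exact: kX|by split|].
have codes : code x p = s.
  by apply/seteqP; split=> m; rewrite /code /code_bit /= subr_gt0 => /sx.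
have Ux := sP x (kX x kx).
apply/eqP => Fx; rewrite Fx mulKf // indicE in Ux.
have [Dx|nDx] := pselect (diagonal_set U p x).
  move: Ux; rewrite mem_set // normr1 => -[+ _].
  by case: Dx; rewrite /= codes => _ /[swap] /[apply]; lra.
move: Ux; rewrite memNset // normr0 => -[_ Ux].
by apply: nDx; split; [split | rewrite /= codes; apply: Ux; lra].
Qed.

End Diagonal.

(** * Independent generators *)

Section Exponents.

Definition prefix_bits (s : set nat) (n : nat) : seq bool := mkseq (fun j => `[< s j >]) n.

(** The instruction (l, n) of w adds n to the exponent of those s whose first bits
are l. The final successor makes every exponent positive, which bounds the
coefficients T^(exponent w s) by T. *)
Definition exponent (w : seq (seq bool * nat)) (s : set nat) : nat :=
  (\sum_(r <- w | r.1 == prefix_bits s (size r.1)) r.2).+1.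

Lemma prefix_bits_separated (k : nat) (s : 'I_k -> set nat) : injective s ->
  exists m, injective (fun i => prefix_bits (s i) m).
Proof.
move=> sI.
have /choice[dif difP] (ij : 'I_k * 'I_k) : exists n,
    (s ij.1 n <-> s ij.2 n) -> ij.1 = ij.2.
  case: ij => i j /=; have [->|ij] := eqVneq i j; first by exists 0%N.
  apply: contrapT => /forallNP H; case/eqP: ij; apply: sI.
  apply/seteqP; split=> n; have /not_implyP[[]] := H n; by [].
pose m := (\max_ij dif ij).+1.
exists m => i j pij; apply: (difP (i, j)) => /=.
have := congr1 (fun l => nth false l (dif (i, j))) pij.
rewrite /= !nth_mkseq ?ltnS; try exact: leq_bigmax.
by move=> eqb; split=> /asboolP; [rewrite eqb|rewrite -eqb] => /asboolP.
Qed.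

(** At a common length m separating the s i, each s i obeys just one instruction
of the list; the predecessor compensates for the successor in [exponent]. *)
Lemma exponent_surj (k : nat) (s : 'I_k -> set nat) (e : 'I_k -> nat) :
  injective s -> (forall i, 0 < e i)%N -> exists w, forall i, exponent w (s i) = e i.
Proof.
move=> sI e0; have [m mI] := prefix_bits_separated sI.
exists [seq (prefix_bits (s i) m, (e i).-1) | i <- index_enum 'I_k] => i.
rewrite /exponent big_map /= (big_pred1 i) ?prednK // => j.
by rewrite /= size_mkseq (inj_eq mI).
Qed.

End Exponents.

Section Generators.
Context {R : realType} {d : Order.disp_t} {W : orderType d}.
Hypothesis wfW : well_founded (fun a b : W => (a < b)%O).
Implicit Types (f : nat -> R -> R) (v : nat -> seq (seq bool * nat)) (s : set nat).

Definition generator f v s (x : R) : R :=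
  limn (series (fun p => (2^-1 ^+ p) ^+ exponent (v p) s * f p x)).

Lemma generator_class (b : W) f v s : (forall p, baire_class setT b (f p)) ->
  (forall p x, `|f p x| <= 1) -> baire_class setT b (generator f v s).
Proof.
move=> fb f1; apply: (@baire_class_dyadic_series _ _ _ wfW setT b
  (fun p x => (2^-1 ^+ p) ^+ exponent (v p) s * f p x)) => [p|p x].
  by apply: baire_classM => //; exact: baire_class_cst.
have h0 : 0 <= 2^-1 ^+ p :> R by rewrite exprn_ge0.
have h1 : 2^-1 ^+ p <= 1 :> R by rewrite exprn_ile1 //; lra.
rewrite normrM ger0_norm ?exprn_ge0 // -[leRHS]mulr1 ler_pM // ?exprn_ge0 //.
by rewrite exprS ler_piMr // exprn_ile1.
Qed.

(** At such a point the generators reduce to a single term, and a polynomial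
without constant term commutes with the factor f p x. *)
Definition only_layer f p x := (f p x = 0 \/ f p x = 1) /\ forall q, q != p -> f q x = 0.

Lemma generator_only_layer f v s p x : only_layer f p x ->
  generator f v s x = (2^-1 ^+ p) ^+ exponent (v p) s * f p x.
Proof.
move=> [_ fq]; apply: cvg_lim => //; apply: cvg_near_cst; near=> n.
have pn : (p < n)%N by near: n; exact: nbhs_infty_gt.
rewrite /series /= big_mkord (bigD1 (Ordinal pn)) //= big1 ?addr0 // => i ip.
by rewrite fq ?mulr0.
Unshelve. all: by end_near. Qed.

Lemma eval_fct_class (b : W) (k : nat) (P : mpoly.mpoly k R) (y : 'I_k -> R -> R) :
  (forall i, baire_class setT b (y i)) -> baire_class setT b (RealPoly.eval_fct P y).
Proof.
move=> yb; rewrite /RealPoly.eval_fct; under eq_fun do rewrite mpoly.mevalE.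
apply: baire_class_sum => // m; apply: baire_classM => //; first exact: baire_class_cst.
by apply: baire_class_prod => // i; apply: baire_classX.
Qed.

Lemma eval_fct_only_layer f v (k : nat) (P : mpoly.mpoly k R) (s : 'I_k -> set nat) p x :
  RealPoly.nonzero_without_constant_term P -> only_layer f p x ->
  RealPoly.eval_fct P (fun i => generator f v (s i)) x =
  RealPoly.eval_fct P (fun i T => T ^+ exponent (v p) (s i)) (2^-1 ^+ p) * f p x.
Proof.
move=> [_ P0] fp; rewrite /RealPoly.eval_fct.
under [fun i => generator _ _ _ _]eq_fun do rewrite (generator_only_layer _ _ fp).
case: fp => -[->|->] _; last by under eq_fun do rewrite mulr1; rewrite mulr1.
by under eq_fun do rewrite mulr0; rewrite mulr0 Kronecker.meval_at0.
Qed.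

(** The roots to be avoided include the 2^-i with i < p0, so that being large is
part of being a nonroot. *)
Lemma nonzero_sample (Q : {poly R}) (h : nat -> nat) (p0 : nat) :
  Q != 0 -> injective h -> exists t, (p0 <= h t)%N /\ Q.[2^-1 ^+ h t] != 0.
Proof.
move=> Q0 hI; pose Q' := Q * \prod_(i < p0) ('X - (2^-1 ^+ i)%:P).
have Q'0 : Q' != 0.
  by rewrite mulf_neq0 //; apply/prodf_neq0 => i _; rewrite polyXsubC_eq0.
pose r := [seq (2^-1 ^+ h t : R) | t <- iota 0 (size Q')].
have [t] : exists t, ~~ root Q' (2^-1 ^+ h t).
  apply: contrapT => /forallNP H.
  have := max_poly_roots Q'0 (rs := r).
  rewrite size_map size_iota ltnn => abs; apply/notF/abs.
    by apply/allP => _ /mapP[t _ ->]; apply: contrapT => /negP; exact: H.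
  rewrite map_inj_uniq ?iota_uniq // => t1 t2 /=.
  move=> /(congr1 GRing.inv); rewrite !exprVn !invrK => /eqP.
  by rewrite -!natrX eqr_nat eqn_exp2l // => /eqP/hI.
rewrite rootM negb_or => /andP[Qt Pt]; exists t; split; last exact: Qt.
rewrite leqNgt; apply/negP => tp; case/negP: Pt.
apply/rootP; rewrite horner_prod; apply/eqP/prodf_eq0.
by exists (Ordinal tp) => //; rewrite hornerXsubC subrr.
Qed.

(** A polynomial in the generators is reduced to what matters about it: it is of
class b, it is a multiple c p of each layer where that layer is alone, and c is
nonzero infinitely often among the p carrying some pattern w. Injectivity of the
family of generators is the case of the difference of two variables. *)
Lemma algebrability_criterion (b : W) f v (S : set (R -> R)) :
  (forall p, baire_class setT b (f p)) -> (forall p x, `|f p x| <= 1) ->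
  (forall F (c : nat -> R) w, baire_class setT b F ->
    (forall p x, only_layer f p x -> F x = c p * f p x) ->
    (forall h : nat -> nat, injective h -> (forall t, v (h t) = w) ->
      forall p0, exists t, (p0 <= h t)%N /\ c (h t) != 0) ->
    F <> cst 0 /\ S F) ->
  strongly_algebrable [set: set nat] S.
Proof.
move=> fb f1 HS.
have evalS (k : nat) (P : mpoly.mpoly k R) (s : 'I_k -> set nat) :
    RealPoly.nonzero_without_constant_term P -> injective s ->
    RealPoly.eval_fct P (fun i => generator f v (s i)) <> cst 0 /\
    S (RealPoly.eval_fct P (fun i => generator f v (s i))).
  move=> P0 sI.
  have [e [Q [e0 Q0 PQ]]] := Kronecker.kronecker_substitution P0.1.
  have [w we] := exponent_surj sI e0.
  apply: (HS _ (fun p => RealPoly.eval_fct P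
    (fun i T => T ^+ exponent (v p) (s i)) (2^-1 ^+ p)) w).
  - by apply: eval_fct_class => i; exact: generator_class.
  - by move=> p x; exact: eval_fct_only_layer.
  - move=> h hI hw p0; have [t [tp Qt]] := nonzero_sample p0 Q0 hI.
    exists t; split=> //; rewrite /RealPoly.eval_fct hw.
    by under eq_fun do rewrite we; rewrite PQ.
have gI : injective (generator f v).
  move=> s s' gss'; apply: contrapT => ss'.
  have [X0 X1 XE] := Kronecker.difference_of_variables R.
  have [|H _] := @evalS 2 _ (fun i => if i == 0 then s else s') (conj X0 X1).
    move=> i j; case: eqP => [->|i0]; case: eqP => [->|j0] // sij; try by case: ss'.
    apply: val_inj; case: i i0 {sij} => [[|[|//]] ?] /= i0; first by case: i0; exact: val_inj.
    by case: j j0 => [[|[|//]] ?] //= j0; case: j0; exact: val_inj.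
  apply: H; apply/funext => x; rewrite /RealPoly.eval_fct XE /= gss'.
  exact: subrr.
exists (range (generator f v)).
  by apply: inj_card_eq => s s' _ _; exact: gI.
move=> k P y _ P0 yI yX.
have /choice[s sy] i : exists s, generator f v s = y i by have [s _ <-] := yX i; exists s.
have -> : y = (fun i => generator f v (s i)) by apply/funext => i; rewrite sy.
apply: evalS => // i j sij; apply: yI.
by rewrite -!sy sij.
Qed.

End Generators.

Section Main.
Context {R : realType} {d : Order.disp_t} {W : orderType d}.
Hypothesis hW : omega1_segment W.
Let wfW := hW.1.

(** Working with all large p, and not just one, leaves room for p to encode a
level and a pattern. *)
Lemma decimal_interval_in_open (V : set R) (x : R) : open V -> V x ->
  exists p0, forall p, (p0 <= p)%N -> exists k : int,
    forall y, k%:~R / 10 ^+ p <= y <= (k + 1)%:~R / 10 ^+ p -> V y.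
Proof.
move=> oV Vx.
have /nbhs_ballP[e /= e0 eV] := open_nbhs_nbhs (conj oV Vx).
have [p0 p0e] := near_dyadic_small e0.
exists p0 => p p0p; exists (Num.floor (10 ^+ p * x)) => y /andP[ky yk].
apply: eV; rewrite /ball /=.
have e10 : 0 < 10 ^+ p :> R by rewrite exprn_gt0.
have /andP[kx xk] := floor_itv (10 ^+ p * x).
move: ky yk kx xk; rewrite ler_pdivrMr // ler_pdivlMr // rmorphD /= [y * _]mulrC.
set z : R := _%:~R => ky yk kx xk.
have : `|10 ^+ p * (x - y)| <= 1 by rewrite mulrBr ler_distlC; apply/andP; split; lra.
rewrite normrM gtr0_norm // mulrC -ler_pdivlMr // mul1r => xy.
apply: le_lt_trans xy _; apply: le_lt_trans p0e.
have e2 : 0 < 2 ^+ p0 :> R by rewrite exprn_gt0.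
rewrite exprVn ler_pdivlMr // mulrC ler_pdivrMr //.
apply: (@le_trans _ _ (2 ^+ p)); first by rewrite ler_eXn2l //; lra.
apply: (@le_trans _ _ (10 ^+ p)); first by rewrite lerXn2r ?nnegrE //; lra.
by rewrite ler_peMl ?ltW //; lra.
Qed.

(** The tent at p takes the value 1 at p and vanishes at the other integers. *)
Lemma algebrable_least (b : W) : (forall a, (b <= a)%O) ->
  strongly_algebrable [set: set nat] (@nowhere_lower_baire_class R d W b).
Proof.
move=> bmin.
pose f (p : nat) (x : R) := ramp 1 (1 - `|x - p%:R|).
pose v (p : nat) : seq (seq bool * nat) :=
  if (unpickle p : option (nat * seq (seq bool * nat))) is Some (_, w) then w else [::].
apply: (@algebrability_criterion R d W wfW b f v) => [p|p x|F c w Fb Fc Hc].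
- apply: (@baire_class_comp _ _ _ wfW _ _ (ramp 1)); first exact: ramp_continuous.
  apply: baire_class_cont => // x; apply: cvgB; first exact: cvg_cst.
  by apply: cvg_norm; apply: cvgB; [exact: cvg_id|exact: cvg_cst].
- exact: norm_ramp_le.
- split; last by split=> // V _ _ [a]; rewrite ltNge bmin.
  have [|t|t [_ ct]] := Hc (fun t : nat => pickle (t, w)) _ _ 0%N.
  + by move=> t t' /(pcan_inj pickleK)[].
  + by rewrite /v pickleK.
  set p := pickle _ in ct.
  have iso : only_layer f p p%:R.
    split=> [|q qp].
      by right; rewrite /f subrr normr0 subr0 ramp_sat.
    rewrite /f ramp_eq0 // subr_le0.
    have [pq|qp'|qp'] := ltngtP p q; last by rewrite qp' eqxx in qp.
      rewrite distrC -natrB ?(ltnW pq) // ger0_norm // ler1n subn_gt0 //.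
    by rewrite -natrB ?(ltnW qp') // ger0_norm // ler1n subn_gt0.
  move=> /(congr1 (fun g : R -> R => g p%:R)) /=; rewrite (Fc p) //.
  by rewrite /f subrr normr0 subr0 ramp_sat // mulr1 => /eqP; apply/negP.
Qed.

(** The layer p encodes a pattern w and an index i of a level e i < b; its first
component only serves to repeat each pair (i, w) infinitely often. *)
Lemma algebrable_greater (b : W) : (exists a, (a < b)%O) ->
  strongly_algebrable [set: set nat] (@nowhere_lower_baire_class R d W b).
Proof.
move=> bgt; have [e [eb esurj]] := enum_below hW bgt.
have /choice[V VP] i := @exists_universal R d W hW (e i).
pose idx (p : nat) : nat * seq (seq bool * nat) :=
  if (unpickle p : option (nat * (nat * seq (seq bool * nat)))) is Some (_, r) then r
    else (0%N, [::]).
have idxE t r : idx (pickle (t : nat, r)) = r by rewrite /idx pickleK.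
pose D p := diagonal_set (V (idx p).1) p.
pose f p : R -> R := \1_(D p).
have iso p x : tagged_set p x -> only_layer f p x.
  move=> px; split=> [|q /eqP qp].
    rewrite /f indicE; case: (x \in D p); by [right | left].
  by rewrite /f indicE memNset // => -[qx _]; apply: qp; exact: tagged_set_disjoint qx px.
apply: (@algebrability_criterion R d W wfW b f (fun p => (idx p).2))
  => [p|p x|F c w Fb Fc Hc].
- exact: diagonal_set_class (eb _) (VP _).
- by rewrite /f indicE; case: (x \in D p); rewrite ?normr1 ?normr0.
have lower (U : set R) : open U -> U !=set0 ->
    ~ exists2 a : W, (a < b)%O & baire_class U a F.
  move=> oU [x Ux] [a ab Fa]; have [i ei] := esurj a ab; subst a.
  have [p0 p0U] := decimal_interval_in_open oU Ux.
  have [|t|t [tp ct]] := Hc (fun t : nat => pickle (t, (i, w))) _ _ p0.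
  + by move=> t t' /(pcan_inj pickleK)[].
  + by rewrite idxE.
  set p := pickle _ in tp ct.
  have [k kU] := p0U p tp.
  have [y [Uy py]] := diagonal_set_neq hW (VP i) Fa ct kU.
  by rewrite (Fc p) ?/f /D ?idxE ?eqxx //; exact: iso.
split; last by split.
move=> F0; apply: (lower setT openT); first by exists 0.
have [a ab] := bgt; exists a => //; rewrite F0.
exact: baire_class_cst.
Qed.

End Main.

Theorem theorem5p5 (R : realType) (d : Order.disp_t) (W : orderType d)
  (hW : omega1_segment W) (b : W) :
  strongly_algebrable [set: set nat] (@nowhere_lower_baire_class R d W b).
Proof.
have [bmin|bgt] := least_or_greater b; first exact: algebrable_least.
exact: algebrable_greater.
Qed.
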